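(* Let $k\ge 1$ and let $p_1,\ldots,p_k$ be nonnegative integers. (i) If $p_1\geq 2$, then $$\operatorname{cox}_{S^{(0)}_{p_1,\ldots,p_k}}(t)=(t+1)\operatorname{cox}_{S^{(0)}_{p_1-1,p_2,\ldots,p_k}}(t)-t\operatorname{cox}_{S^{(0)}_{p_1-2,p_2,\ldots,p_k}}(t).$$ (ii) If $k\geq2$ and $p_1\geq3$, then for all $i\in\{1,\ldots,k\}$ (with $p_2,\ldots,p_i\ge 3$, so that the Dynkin diagrams $\mathbb D_{p_2},\ldots,\mathbb D_{p_i}$ are defined) $$\operatorname{cox}_{S^{(i)}_{p_1,\ldots,p_k}}(t)=(t+1)\left[\operatorname{cox}_{S^{(i-1)}_{p_2,\ldots,p_k,p_1-1}}(t)-t\operatorname{cox}_{S^{(i-1)}_{p_2,\ldots,p_k,p_1-3}}(t)\right].$$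
   Context: Coxeter polynomial. Let $\Gamma$ be a tree (or, more generally, a forest) with vertices $v_1,\ldots,v_n$ and adjacency matrix $[a_{ij}]$. For $1\le i\le n$ let $\sigma_i:\mathbb R^n\to\mathbb R^n$ be the linear map with $\sigma_i(e_j)=e_j-(2\delta_{ij}-a_{ij})e_i$, where $e_1,\ldots,e_n$ is the standard basis. The Coxeter transformation is $\Phi_\Gamma=\sigma_1\sigma_2\cdots\sigma_n$, and the Coxeter polynomial is its characteristic polynomial $\operatorname{cox}_\Gamma(t)=\det(t\cdot\mathrm{id}-\Phi_\Gamma)\in\mathbb Z[t]$; it does not depend on the enumeration of the vertices. Join. The join of graphs $\Gamma_1,\ldots,\Gamma_k$ with a fixed vertex $v_j$ in each $\Gamma_j$ is the graph obtained from their disjoint union by adding a new vertex $v$ and an edge from $v$ to $v_j$ for every $j=1,\ldots,k$. Dynkin diagrams. $\mathbb A_n$ is the path with vertices $1,2,\ldots,n$ (edges between consecutive numbers); $\mathbb A_0$ is the empty graph. For $n\ge 3$, $\mathbb D_n$ is the tree with vertices $1,\ldots,n$ consisting of the path $1,2,\ldots,n-2$ together with two further vertices $n-1$ and $n$, each joined by an edge to the vertex $n-2$. The trees $S^{(i)}_{p_1,\ldots,p_k}$. For $0\le i\le k$, $S^{(i)}_{p_1,\ldots,p_k}$ is the join of $\mathbb D_{p_1},\ldots,\mathbb D_{p_i},\mathbb A_{p_{i+1}},\ldots,\mathbb A_{p_k}$ at their vertices numbered $1$. If some type $\mathbb A$ index is $0$, the corresponding branch is simply absent. *)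

(* Defs.v *)
From HB Require Import structures.
From mathcomp Require Import all_boot all_order all_algebra zify.

Set Implicit Arguments.
Unset Strict Implicit.
Unset Printing Implicit Defensive.

Import Order.TTheory GRing.Theory Num.Theory.
Local Open Scope ring_scope.

Record sgraph := SGraph {
  vertex :> finType;
  adj : rel vertex;
  adj_sym : symmetric adj;
  adj_irrefl : irreflexive adj }.

Record enumeration (G : sgraph) := Enumeration {
  enum_fun :> 'I_#|G| -> G;
  enum_fun_bij : bijective enum_fun }.

Section Coxeter.
Variables (G : sgraph) (v : enumeration G).

Definition adjacency : 'M[int]_#|G| := \matrix_(i, j) (adj (v i) (v j))%:R.

(* Matrices act on column vectors, so column j is the image of e_j; all
   entries are integers, hence the characteristic polynomial is taken over
   int and not over the reals. *)
Definition sigma (i : 'I_#|G|) : 'M[int]_#|G| :=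
  \matrix_(r, j) ((r == j)%:R
                  - (2%:R * (i == j)%:R - adjacency i j) * (r == i)%:R).

Lemma sigma_basis (i j : 'I_#|G|) :
  sigma i *m delta_mx j 0 =
  delta_mx j 0 - (2%:R * (i == j)%:R - adjacency i j) *: delta_mx i 0
    :> 'cV[int]_#|G|.
Proof.
by rewrite -colE; apply/matrixP => r c; rewrite (ord1 c) !mxE !andbT.
Qed.

Definition coxeter : 'M[int]_#|G| := \big[mulmx/1%:M]_(i < #|G|) sigma i.

Definition cox : {poly int} := char_poly coxeter.

End Coxeter.

Section Join.
Variables (I : finType) (G : I -> sgraph) (root : forall j, option (G j)).

Definition join_adj (x y : option {j : I & G j}) : bool :=
  match x, y with
  | None, None => false
  | None, Some b => root (tag b) == Some (tagged b)
  | Some a, None => root (tag a) == Some (tagged a)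
  | Some a, Some b =>
      (tag a == tag b) && adj (tagged a) (tagged_as a b)
  end.

Lemma join_adj_sym : symmetric join_adj.
Proof.
case=> [[i x]|] [[j y]|] //=.
case: (eqVneq i j) y => [<- y|ne y]; last by [].
by rewrite !tagged_asE adj_sym.
Qed.

Lemma join_adj_irrefl : irreflexive join_adj.
Proof. by case=> [[i x]|] //=; rewrite eqxx tagged_asE adj_irrefl. Qed.

(* The new vertex is None. A branch whose root is None is left unattached;
   this is only used for the empty graph, which has no vertex to attach. *)
Definition join : sgraph := SGraph join_adj_sym join_adj_irrefl.

End Join.

Inductive dynkin_type := TypeA | TypeD.

(* Edges {a, b} listed with a < b, on vertices numbered from 1. *)
Definition dynkin_edge (X : dynkin_type) (n a b : nat) : bool :=
  match X with
  | TypeA => b == a.+1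
  | TypeD => (b == a.+1) && (b <= n - 2)%N
             || (a == n - 2)%N && ((b == n - 1)%N || (b == n))
  end.

(* The ordinal x : 'I_n is the vertex numbered x + 1. *)
Definition dynkin_adj (X : dynkin_type) (n : nat) (x y : 'I_n) : bool :=
  dynkin_edge X n x.+1 y.+1 || dynkin_edge X n y.+1 x.+1.

Lemma dynkin_adj_sym X n : symmetric (@dynkin_adj X n).
Proof. by move=> x y; rewrite /dynkin_adj orbC. Qed.

Lemma dynkin_adj_irrefl X n : irreflexive (@dynkin_adj X n).
Proof. by case: X => x; rewrite /dynkin_adj /dynkin_edge; lia. Qed.

(* Meaningful for type D only when n >= 3. *)
Definition dynkin (X : dynkin_type) (n : nat) : sgraph :=
  SGraph (@dynkin_adj_sym X n) (@dynkin_adj_irrefl X n).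

(* The vertex numbered 1; None exactly when n = 0. *)
Definition vertex1 (X : dynkin_type) (n : nat) : option (dynkin X n) :=
  insub 0%N.

(* S^(i) for the sequence p = [:: p_1; ...; p_k]; the branch p_j has index
   j - 1 in p, and is of type D when j <= i. *)
Definition Stree (i : nat) (p : seq nat) : sgraph :=
  join (fun j : 'I_(size p) =>
          vertex1 (if (j < i)%N then TypeD else TypeA) (nth 0%N p j)).

(* Main.v *)
Require Import Defs.
From mathcomp Require Import all_boot all_order all_algebra all_fingroup zify ring.

Set Implicit Arguments.
Unset Strict Implicit.
Unset Printing Implicit Defensive.

Import GRing.Theory.
Local Open Scope ring_scope.

(* If U is the identity minus the strictly upper triangular part of the
   adjacency matrix, then U * Phi = - U^T, so cox = det (t U + U^T). On a
   forest such a determinant depends only on the diagonal entries t + 1 and on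
   the products t of opposite entries, by expansion along leaves; hence any
   ordering of the vertices and any choice of weights may be used. Expanding
   at a leaf x with neighbour y gives
     cox_G = (t + 1) cox_(G - x) - t cox_(G - {x, y}).
   In (i) x is the end of the path A_(p_1); in (ii) x is one of the two leaves
   at the fork of D_(p_1), and removing x and y isolates the other leaf, which
   contributes the extra factor t + 1. *)

(** * Determinants indexed by lists, and their expansion on forests *)

Section ListDeterminant.
Variable R : comNzRingType.

(** Indexing by a list turns deletion and reordering of vertices into list operations, with no casts
    between matrix sizes. *)
Definition ldet (T : Type) (F : T -> T -> R) (L : seq T) : R :=
  \det (\matrix_(i < size L, j < size L)
          F (tnth (in_tuple L) i) (tnth (in_tuple L) j)).

Lemma ldet_tuple (T : Type) (F : T -> T -> R) n (t : n.-tuple T) :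
  ldet F t = \det (\matrix_(i < n, j < n) F (tnth t i) (tnth t j)).
Proof.
case: t => L sz; have /eqP Ln := sz; subst n.
congr (\det _); apply/matrixP => i j; rewrite !mxE.
have x : T := tnth (in_tuple L) i.
by rewrite !(tnth_nth x).
Qed.

Lemma ldet_map (S T : Type) (F : T -> T -> R) (g : S -> T) (L : seq S) :
  ldet F (map g L) = ldet (fun x y => F (g x) (g y)) L.
Proof.
rewrite -[map g L]/(tval (map_tuple g (in_tuple L))) ldet_tuple.
by congr (\det _); apply/matrixP => i j; rewrite !mxE !tnth_map.
Qed.

Lemma ldet_perm (T : eqType) (F : T -> T -> R) (L L' : seq T) :
  perm_eq L L' -> ldet F L = ldet F L'.
Proof.
move=> LL'; have /eqP sz := perm_size LL'.
rewrite -[L]/(tval (Tuple sz)) ldet_tuple.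
have /tuple_permP[s Ls] : perm_eq (Tuple sz) (in_tuple L') by [].
rewrite (_ : \matrix_(i, j) _ = row_perm s (col_perm s
  (\matrix_(i, j) F (tnth (in_tuple L') i) (tnth (in_tuple L') j)))); last first.
  by apply/matrixP => i j; rewrite !mxE (val_inj Ls) !tnth_mktuple.
(* The signs of [s] and of its inverse, coming from rows and columns, cancel. *)
rewrite row_permE col_permE !det_mulmx !det_perm mulrCA.
by rewrite -signr_addb odd_permV addbb mulr1.
Qed.

Lemma ldet0 (T : Type) (F : T -> T -> R) : ldet F [::] = 1.
Proof. exact: det_mx00. Qed.

Lemma ldet_isolated (T : eqType) (F : T -> T -> R) x (L : seq T) :
  {in L, forall z, F x z = 0} -> ldet F (x :: L) = F x x * ldet F L.
Proof.
move=> F0; rewrite /ldet (expand_det_row _ ord0) big_ord_recl big1 => [|j _].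
  rewrite addr0 /cofactor expr0 mul1r !mxE; congr (_ * \det _).
  by apply/matrixP => i j; rewrite !mxE !(tnth_nth x).
by rewrite !mxE !(tnth_nth x) /= F0 ?mul0r // mem_nth // [(_ < _)%N]ltn_ord.
Qed.

(** Expansion along the row of [x] leaves two minors; in the one belonging to [F x y], the column of
    [x] can be nonzero only at [F y x]. *)
Lemma ldet_leaf (T : eqType) (F : T -> T -> R) x y (L : seq T) :
  {in L, forall z, F x z = 0 /\ F z x = 0} ->
  ldet F [:: x, y & L] =
    F x x * ldet F (y :: L) - F x y * F y x * ldet F L.
Proof.
move=> F0; rewrite /ldet (expand_det_row _ ord0) !big_ord_recl big1 => [|j _].
  rewrite addr0 /cofactor expr0 mul1r !mxE; congr (_ * \det _ + _).
    by apply/matrixP => i j; rewrite !mxE !(tnth_nth x).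
  rewrite (expand_det_col _ ord0) big_ord_recl big1 => [|j _].
    rewrite /cofactor !mxE addr0 expr0 expr1 !mul1r mulN1r mulrN mulrA.
    congr (- (_ * _ * \det _)).
    by apply/matrixP => i j; rewrite !mxE !(tnth_nth x).
  by rewrite !mxE !(tnth_nth x) /= (proj2 (F0 _ _)) ?mul0r // mem_nth // [(_ < _)%N]ltn_ord.
by rewrite !mxE !(tnth_nth x) /= (proj1 (F0 _ _)) ?mul0r // mem_nth // [(_ < _)%N]ltn_ord.
Qed.

(* This makes r a forest: an element of maximal rank in a finite set has at
   most one neighbour in that set. *)
Definition forest_rank (T : eqType) (r : rel T) (rk : T -> nat) :=
  forall x y z, r x y -> r x z -> (rk y <= rk x)%N -> (rk z <= rk x)%N -> y = z.

Definition weighting (T : eqType) (r : rel T) (c t : R) (F : T -> T -> R) :=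
  forall x y, [/\ F x x = c, x != y -> ~~ r x y -> F x y = 0
                & x != y -> r x y -> F x y * F y x = t].

(** A vertex of maximal rank in the list is isolated or a leaf there, and expanding at it involves
    only [c], [t] and shorter lists. *)
Lemma ldet_forest (T : eqType) (r : rel T) (rk : T -> nat) c t F F' :
    symmetric r -> forest_rank r rk ->
    weighting r c t F -> weighting r c t F' ->
  forall L : seq T, uniq L -> ldet F L = ldet F' L.
Proof.
(* The induction is on a bound for the size, since the leaf case needs lists shorter by one and by
   two. *)
move=> r_sym r_rk wF wF' L; move: {2}(size L) (leqnn (size L)) => n.
elim: n L => [|n IH] [|a L1] // Ln; rewrite ?ldet0 //.
have [x xL xmax] : exists2 x, x \in a :: L1
    & {in a :: L1, forall z, (rk z <= rk x)%N}.
  elim: L1 {Ln} a => [|b L IHL] a.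
    by exists a; rewrite ?mem_head // => z; rewrite inE => /eqP->.
  have [x xL xmax] := IHL b; have [ax|xa] := leqP (rk a) (rk x).
    exists x; first by rewrite inE xL orbT.
    by move=> z; rewrite inE => /orP[/eqP->|/xmax].
  exists a; first exact: mem_head.
  move=> z; rewrite inE => /orP[/eqP->//|/xmax zx].
  exact: leq_trans zx (ltnW xa).
move: (a :: L1) xL xmax Ln => {L1 a} L xL xmax Ln.
have pL := perm_to_rem xL; rewrite (perm_uniq pL) !(ldet_perm _ pL).
move: (rem x L) pL => L1 pL /andP[xL1 uL1].
have {}Ln : (size L1 <= n)%N by move: Ln; rewrite (perm_size pL).
have {}xmax : {in L1, forall z, (rk z <= rk x)%N}.
  by move=> z zL; apply: xmax; rewrite (perm_mem pL) inE zL orbT.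
have [[Fx _ _] [Fx' _ _]] := (wF x x, wF' x x).
have neq z : z \in L1 -> x != z by move=> zL; apply: contraNneq xL1 => ->.
have [/hasP[y yL rxy]|/hasPn nr] := boolP (has (r x) L1).
  have pL1 : perm_eq (x :: L1) [:: x, y & rem y L1].
    by rewrite perm_cons perm_to_rem.
  (* As [x] has maximal rank, [forest_rank] identifies every neighbour of [x] in the list with
     [y]. *)
  have nr z : z \in rem y L1 -> (x != z) && ~~ r x z.
    rewrite mem_rem_uniq // !inE => /andP[zy zL]; rewrite neq //=.
    by apply: contraNN zy => rxz; rewrite (r_rk x z y) ?xmax.
  have F0 H : weighting r c t H ->
      {in rem y L1, forall z, H x z = 0 /\ H z x = 0}.
    move=> wH z /nr/andP[xz rxz].
    have [[_ /(_ xz rxz) -> _] [_ H0 _]] := (wH x z, wH z x).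
    by rewrite H0 // 1?eq_sym // r_sym.
  rewrite !(ldet_perm _ pL1) !ldet_leaf; [|exact: F0..].
  rewrite -!(ldet_perm _ (perm_to_rem yL)) (IH L1) // (IH (rem y L1)); first last.
  - exact: rem_uniq.
  - by rewrite size_rem // (leq_trans (leq_pred _)).
  have xy := neq _ yL; have [[_ _ e] [_ _ e']] := (wF x y, wF' x y).
  by rewrite Fx Fx' e // e'.
have F0 H : weighting r c t H -> {in L1, forall z, H x z = 0}.
  by move=> wH z zL; have [_ ->] := wH x z; rewrite ?neq ?nr.
rewrite !ldet_isolated; [|exact: F0..].
by rewrite Fx Fx' IH.
Qed.

End ListDeterminant.

(** * The Coxeter polynomial as the determinant of t U + U^T *)

Section CoxeterDeterminant.
Variables (G : sgraph) (u : enumeration G).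
Local Notation n := #|G|.
Local Notation a := (adjacency u).

(* The i-th reflection changes only the i-th coordinate, so in the image of a
   vector under the product each coordinate is computed from the new values of
   the later coordinates and the old values of the earlier ones. *)
Lemma sigma_prod_entry (s : seq 'I_n) :
    pairwise (fun i j : 'I_n => (i < j)%N) s ->
  let Q := \big[mulmx/1%:M]_(i <- s) sigma u i in
  forall r c, Q r c = if r \in s then
      - (r == c)%:R + \sum_(j < n | (j < r)%N) a r j * (j == c)%:R
                    + \sum_(j < n | (r < j)%N) a r j * Q j c
    else (r == c)%:R.
Proof.
elim: s => [|r0 s IH] /=; first by move=> _ r c; rewrite big_nil !mxE.
move=> /andP[/allP r0s /IH {}IH] r c; rewrite big_cons.
move: (\big[_/_]_(_ <- _) _) IH => Q IH.
have E i d : (sigma u r0 *m Q) i d = if i == r0 then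
    Q r0 d - (2%:R * Q r0 d - \sum_j a r0 j * Q j d) else Q i d.
  rewrite !mxE.
  under eq_bigr do rewrite mxE mulrBl.
  rewrite sumrB (bigD1 i) //= eqxx mul1r big1 ?addr0; last first.
    by move=> j /negPf ji; rewrite eq_sym ji mul0r.
  have [->|ne] := eqVneq i r0; last first.
    by rewrite big1 ?subr0 // => j _; rewrite mulr0 mul0r.
  congr (_ - _).
  under eq_bigr do rewrite mulr1 mulrBl.
  rewrite sumrB (bigD1 r0) //= eqxx mulr1 big1 ?addr0 // => j /negPf jr.
  by rewrite eq_sym jr mulr0 mul0r.
rewrite E inE; case: eqVneq => [->|ne] /=; last first.
  rewrite {1}IH; case: ifP => // rs; congr (_ + _).
  apply: eq_bigr => j rj; rewrite E ifN //.
  by apply: contraTneq rj => ->; rewrite -leqNgt ltnW ?r0s.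
(* The list is increasing, so indices up to [r0] do not occur in its tail and these rows of [Q] are
   still rows of the identity. *)
have Q0 (j : 'I_n) : (j <= r0)%N -> Q j c = (j == c)%:R.
  by move=> jr; rewrite IH ifN //; apply: contraTN jr => /r0s; rewrite ltnNge.
rewrite Q0 // (bigD1 r0) //= [a r0 r0]mxE adj_irrefl mul0r add0r.
rewrite (bigID (fun j : 'I_n => (j < r0)%N)) /=.
have -> : \sum_(j | (j != r0) && (j < r0)%N) a r0 j * Q j c
    = \sum_(j < n | (j < r0)%N) a r0 j * (j == c)%:R.
  apply: eq_big => [j|j /andP[_ jr]]; last by rewrite Q0 // ltnW.
  by rewrite andb_idl // => jr; apply: contraTneq jr => ->; rewrite ltnn.
have -> : \sum_(j | (j != r0) && ~~ (j < r0)%N) a r0 j * Q j c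
    = \sum_(j < n | (r0 < j)%N) a r0 j * (sigma u r0 *m Q) j c.
  apply: eq_big => [j|j /andP[jr _]]; last by rewrite E ifN.
  by rewrite -leqNgt ltn_neqAle eq_sym.
ring.
Qed.

Definition coxeter_upper : 'M[int]_n :=
  \matrix_(i, j) ((i == j)%:R - a i j *+ (i < j)%N).

(** In [sigma_prod_entry] for all indices, moving the sum over j > r to the left gives row r of U
    Phi; what stays on the right is row r of - U^T. *)
Lemma coxeter_upperE : coxeter_upper *m coxeter u = - coxeter_upper^T.
Proof.
apply/matrixP => r c; rewrite !mxE.
under eq_bigr do rewrite mxE mulrBl.
rewrite sumrB (bigD1 r) //= eqxx mul1r big1 ?addr0; last first.
  by move=> j /negPf jr; rewrite eq_sym jr mul0r.
have srt : pairwise (fun i j : 'I_n => (i < j)%N) (index_enum 'I_n).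
  by rewrite -[index_enum _]enumT -(pairwise_map val ltn) val_enum_ord
             -sorted_pairwise ?iota_ltn_sorted //; apply: ltn_trans.
rewrite {1}/coxeter (sigma_prod_entry srt) mem_index_enum -/(coxeter u).
have -> : \sum_j a r j *+ (r < j)%N * coxeter u j c
    = \sum_(j < n | (r < j)%N) a r j * coxeter u j c.
  rewrite [RHS]big_mkcond; apply: eq_bigr => j _.
  by case: ifP => _; rewrite ?mulr1n // mulr0n mul0r.
have -> : \sum_(j < n | (j < r)%N) a r j * (j == c)%:R = a c r *+ (c < r)%N.
  rewrite big_mkcond (bigD1 c) //= eqxx mulr1 big1 ?addr0 => [|j /negPf jc].
    by rewrite !mxE adj_sym; case: ifP.
  by rewrite jc mulr0 if_same.
by rewrite addrK mxE opprB addrC eq_sym.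
Qed.

(** U is unitriangular, so multiplying t - Phi by it keeps the determinant and yields t U + U^T. *)
Lemma cox_det : cox u = \det (\matrix_(i < n, j < n)
  (if i == j then 'X + 1 else
   if adj (u i) (u j) then if (i < j)%N then - 'X else - 1 else 0)).
Proof.
have det_upper : \det (map_mx polyC coxeter_upper) = 1.
  rewrite det_map_mx -det_tr det_trig ?big1 // => [i _|].
    by rewrite !mxE eqxx ltnn subr0.
  apply/is_trig_mxP => i j ij.
  by rewrite !mxE -val_eqE /= gtn_eqF // ltnNge ltnW // subr0.
transitivity (\det (map_mx polyC coxeter_upper) * cox u).
  by rewrite det_upper mul1r.
rewrite /cox /char_poly -det_mulmx /char_poly_mx.
rewrite mulmxBr -map_mxM coxeter_upperE mul_mx_scalar.
congr (\det _); apply/matrixP => i j; rewrite !mxE.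
have [->|ij] := eqVneq i j.
  by rewrite ltnn subr0 rmorphN /= opprK mulr1.
rewrite adj_sym !sub0r opprK.
case: (adj (u j) (u i)); last by rewrite !mul0rn oppr0 polyC0 mulr0 subr0.
case: (ltngtP i j) => [_|_|/val_inj e]; last by rewrite e eqxx in ij.
  by rewrite mulr1n mulr0n rmorph0 subr0 polyCN mulrN1.
by rewrite mulr1n mulr0n oppr0 mulr0 sub0r rmorph1.
Qed.

End CoxeterDeterminant.

(** * Independence of the enumeration *)

Definition cox_weight (T : eqType) (r : rel T) (rk : T -> nat) (x y : T) :
    {poly int} :=
  if x == y then 'X + 1
  else if r x y then if (rk x < rk y)%N then - 'X else - 1 else 0.

(** Orienting edges by rank instead of by position preserves the diagonal and the products of
    opposite entries, so [ldet_forest] applies. Through [code], different graphs are compared inside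
    one type. *)
Lemma cox_ldet (G : sgraph) (u : enumeration G) (T : eqType) (code : G -> T)
    (r : rel T) (rk : T -> nat) (L : seq T) :
    injective code -> (forall x y, r (code x) (code y) = adj x y) ->
    forest_rank r rk -> (forall x y, r x y -> rk x != rk y) ->
    perm_eq [seq code x | x : G] L ->
  cox u = ldet (cox_weight r rk) L.
Proof.
move=> code_inj code_adj r_rk r_neq GL.
have u_inj := bij_inj (enum_fun_bij u).
have uL : perm_eq L [seq code (u i) | i <- enum 'I_#|G|].
  rewrite map_comp perm_sym -(permPr GL) perm_map //.
  apply: uniq_perm => [||x]; first by rewrite map_inj_uniq ?enum_uniq.
    exact: enum_uniq.
  have [v _ vK] := enum_fun_bij u.
  by rewrite -[x]vK mem_map ?mem_enum.
rewrite (ldet_perm _ uL) ldet_map cox_det.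
pose F (i j : 'I_#|G|) : {poly int} := if i == j then 'X + 1 else
  if adj (u i) (u j) then if (i < j)%N then - 'X else - 1 else 0.
have -> : \det (\matrix_(i, j) F i j) = ldet F (ord_tuple #|G|).
  rewrite ldet_tuple; congr (\det _).
  by apply/matrixP => i j; rewrite !mxE !tnth_ord_tuple.
rewrite val_ord_tuple.
apply: (@ldet_forest _ _ (fun i j => adj (u i) (u j))
  (fun i => rk (code (u i))) ('X + 1) 'X); last exact: enum_uniq.
- by move=> i j; rewrite adj_sym.
- move=> i j k; rewrite -!code_adj => ij ik ji ki.
  exact/u_inj/code_inj/(r_rk _ _ _ ij ik).
- move=> i j; rewrite /F eqxx; split=> // [/negPf-> /negPf-> //|ij].
  rewrite [j == i]eq_sym (negPf ij) [adj (u j) _]adj_sym => ->.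
  case: (ltngtP i j) => [_|_|/val_inj e]; last by rewrite e eqxx in ij.
    by rewrite mulrNN mulr1.
  by rewrite mulrNN mul1r.
move=> i j; rewrite /cox_weight !(inj_eq code_inj) !(inj_eq u_inj) !code_adj eqxx.
split=> // [/negPf-> /negPf-> //|ij].
rewrite [j == i]eq_sym (negPf ij) [adj (u j) _]adj_sym => aij.
(* Adjacent vertices of equal rank would receive - 1 in both entries, with product 1 instead of
   t. *)
have := r_neq (code (u i)) (code (u j)); rewrite code_adj aij => /(_ isT).
by case: ltngtP => // _ _; rewrite mulrNN ?mulr1 ?mul1r.
Qed.

Lemma vertex1E Y n (x : dynkin Y n) :
  (nat_of_ord x == 0%N) = (vertex1 Y n == Some x).
Proof.
apply/eqP/eqP => [x0|]; last by rewrite /vertex1; case: insubP => // y _ + [<-].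
rewrite /vertex1; case: insubP => [y _ y0|/negP[]]; last by rewrite -x0.
by congr Some; apply: val_inj; rewrite /= x0.
Qed.

(** * The trees S^(i) encoded by pairs of branch and position *)

Section Codes.
Variables (X : nat -> dynkin_type) (m : nat -> nat).

(** Edges point away from the centre. [X] and [m] describe the branches of an ambient tree, so
    deleting vertices from a list leaves the relation unchanged. *)
Definition code_edge (a b : option (nat * nat)) : bool :=
  match a, b with
  | None, Some (_, y) => y == 0%N
  | Some (j, x), Some (k, y) => (j == k) && dynkin_edge (X j) (m j) x.+1 y.+1
  | _, None => false
  end.

Definition code_adj : rel (option (nat * nat)) :=
  fun a b => code_edge a b || code_edge b a.

Definition height (a : option (nat * nat)) : nat :=
  if a is Some (_, x) then x.+1 else 0%N.

Lemma code_edge_height a b : code_edge a b -> (height a < height b)%N.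
Proof.
by case: a b => [[j x]|] [[k y]|] //= /andP[_]; case: (X j) => /=; lia.
Qed.

(** Parents are unique: the predecessor on a path, the fork vertex for both leaves of a type D
    branch, the centre for position 0. *)
Lemma code_edge_inj a b c : code_edge a c -> code_edge b c -> a = b.
Proof.
case: a b c => [[j x]|] [[k y]|] [[l z]|] //=.
- move=> /andP[/eqP-> xz] /andP[/eqP-> yz]; congr (Some (_, _)).
  by move: xz yz; case: (X l) => /=; lia.
- by move=> /andP[_ +] /eqP z0; case: (X j) => /=; lia.
- by move=> /eqP z0 /andP[_]; case: (X k) => /=; lia.
Qed.

Lemma code_adj_height a b : code_adj a b -> height a != height b.
Proof. by case/orP => /code_edge_height; lia. Qed.

(** A neighbour that is not higher is the parent, which is unique. *)
Lemma code_adj_forest : forest_rank code_adj height.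
Proof.
have down a b : code_adj a b -> (height b <= height a)%N -> code_edge b a.
  by case/orP => // /code_edge_height; lia.
move=> a b c ab ac ba ca; exact: code_edge_inj (down _ _ ab ba) (down _ _ ac ca).
Qed.

(* None is the centre of the star; vertex x + 1 of branch j, counted from 0, is
   encoded as (h j, x). *)
Definition codes (h : nat -> nat) (p : seq nat) : seq (option (nat * nat)) :=
  None :: [seq Some (h j, x) | j <- iota 0 (size p), x <- iota 0 (nth 0 p j)]%N.

Lemma codes_uniq h p : {in gtn (size p) &, injective h} -> uniq (codes h p).
Proof.
move=> h_inj; rewrite /codes cons_uniq; apply/andP; split.
  by apply/negP => /allpairsPdep[j [x []]].
apply: allpairs_uniq_dep => [|j _|]; rewrite ?iota_uniq //.
move=> _ _ /allpairsPdep[j [x [+ _ ->]]] /allpairsPdep[k [y [+ _ ->]]] /=.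
by rewrite !mem_iota /= add0n => jp kp [/h_inj-> // ->].
Qed.

(** Edges have to agree only on vertices that are present, so a smaller tree, with branches renamed
    by [h], can be read inside a larger one. *)
Lemma cox_Stree (i : nat) (p : seq nat) (h : nat -> nat)
    (u : enumeration (Stree i p)) :
    {in gtn (size p) &, injective h} ->
    (forall j x y, (j < size p)%N -> (x < nth 0%N p j)%N -> (y < nth 0%N p j)%N ->
       dynkin_edge (X (h j)) (m (h j)) x.+1 y.+1 =
       dynkin_edge (if (j < i)%N then TypeD else TypeA) (nth 0%N p j) x.+1 y.+1) ->
  cox u = ldet (cox_weight code_adj height) (codes h p).
Proof.
move=> h_inj h_edge.
pose B (j : 'I_(size p)) :=
  dynkin (if (j < i)%N then TypeD else TypeA) (nth 0%N p j).
pose code (a : option {j : 'I_(size p) & B j}) : option (nat * nat) :=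
  if a is Some (existT j x) then Some (h j, nat_of_ord x) else None.
have code_inj : injective code.
  move=> [[j x]|] [[k y]|] //= [/h_inj]; rewrite !inE !ltn_ord.
  by move=> /(_ isT isT)/val_inj jk; case: k / jk y => y /val_inj->.
apply: (@cox_ldet (Stree i p) u _ code _ _ _ code_inj) => [a b|||].
- rewrite /code_adj; case: a b => [[j x]|] [[k y]|] //=.
  + have [jk|jk] := eqVneq j k.
      case: k / jk y => y; rewrite !eqxx tagged_asE /= !h_edge //.
    have hjk : (h j == h k) = false.
      by rewrite (inj_in_eq h_inj) ?inE ?ltn_ord //; apply: negPf.
    by rewrite hjk eq_sym hjk.
  + exact: vertex1E.
  + by rewrite orbF; apply: vertex1E.
- exact: code_adj_forest.
- exact: code_adj_height.
apply: uniq_perm => [||c].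
- by rewrite map_inj_uniq ?enum_uniq.
- exact: codes_uniq.
apply/imageP/idP => [[a _ ->]|].
  rewrite inE; case: a => [[j x]|] //=; apply/allpairsPdep.
  by exists (nat_of_ord j), (nat_of_ord x); rewrite !mem_iota !ltn_ord.
rewrite inE; case/predU1P => [->|]; first by exists None.
case/allpairsPdep => j [x [+ + ->]]; rewrite !mem_iota /= => jp xp.
by exists (Some (existT (fun j : 'I_(size p) => B j) (Ordinal jp) (Ordinal xp))).
Qed.

Local Notation W := (cox_weight code_adj height).

(** Here [x] is a leaf: it has no child in [L], and uniqueness of parents excludes any neighbour in
    [L] besides. *)
Lemma ldet_code_leaf x y L :
    uniq [:: x, y & L] -> code_edge y x -> {in L, forall z, ~~ code_edge x z} ->
  ldet W [:: x, y & L] = ('X + 1) * ldet W (y :: L) - 'X * ldet W L.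
Proof.
rewrite /= inE negb_or => /and3P[/andP[xy xL] yL _] yx nx.
have nadj z : z \in L -> (code_adj x z = false) * (code_adj z x = false).
  move=> zL; rewrite /code_adj orbC (negPf (nx z zL)) orbF.
  suff /negPf-> : ~~ code_edge z x by [].
  by apply: contraNN yL => zx; rewrite (code_edge_inj yx zx).
rewrite ldet_leaf => [|z zL].
  rewrite /cox_weight !eqxx [y == x]eq_sym (negPf xy) /code_adj yx orbT.
  have yx_lt := code_edge_height yx.
  by rewrite yx_lt ltnNge (ltnW yx_lt) mulrNN mul1r.
rewrite /cox_weight !(nadj z zL).
have /negPf xz : x != z by apply: contraNneq xL => ->.
by rewrite [z == x]eq_sym xz.
Qed.

Lemma ldet_code_isolated x L :
    x \notin L -> {in L, forall z, ~~ code_adj x z} ->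
  ldet W (x :: L) = ('X + 1) * ldet W L.
Proof.
move=> xL nx; rewrite ldet_isolated => [|z zL].
  by rewrite /cox_weight eqxx.
have /negPf xz : x != z by apply: contraNneq xL => ->.
by rewrite /cox_weight xz (negPf (nx z zL)).
Qed.

End Codes.

(** * Lengthening and rotating lists of codes *)

Lemma mem_codes k y p :
  Some (k, y) \in codes id p -> (k < size p)%N /\ (y < nth 0%N p k)%N.
Proof.
rewrite inE => /allpairsPdep[j [x [+ + [-> ->]]]].
by rewrite !mem_iota.
Qed.

Lemma codes_cons q ps : codes id (q :: ps) =
  None :: [seq Some (0%N, x) | x <- iota 0 q] ++
    [seq Some (j.+1, x) | j <- iota 0 (size ps), x <- iota 0 (nth 0%N ps j)].
Proof.
rewrite /codes /=; congr (_ :: _ ++ _).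
by rewrite (iotaDl 1 0) -map_comp.
Qed.

Lemma perm_codes_cons q ps :
  perm_eq (codes id (q.+1 :: ps)) (Some (0%N, q) :: codes id (q :: ps)).
Proof.
rewrite !codes_cons -addn1 iotaD map_cat -catA -!cat_cons -[X in perm_eq _ X]cat1s.
by rewrite perm_catCA.
Qed.

(* Sends the last branch of rcons ps q back to the first branch of q :: ps. *)
Definition unrotate (n j : nat) : nat := if (j < n)%N then j.+1 else 0%N.

Lemma perm_codes_rcons q ps :
  perm_eq (codes (unrotate (size ps)) (rcons ps q)) (codes id (q :: ps)).
Proof.
rewrite codes_cons perm_cons perm_sym size_rcons -addn1 iotaD map_cat flatten_cat.
rewrite /= cats0 nth_rcons ltnn eqxx /unrotate ltnn perm_catC.
apply/seq.permP => a; congr (count _ (flatten _ ++ _)); apply/eq_in_map => j.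
by rewrite mem_iota => /= jp; rewrite nth_rcons jp.
Qed.

(** * The two recursions *)

Theorem theorem2p1 (p1 : nat) (ps : seq nat) :
  ((2 <= p1)%N ->
   forall (u : enumeration (Stree 0 (p1 :: ps)))
          (v : enumeration (Stree 0 ((p1 - 1)%N :: ps)))
          (w : enumeration (Stree 0 ((p1 - 2)%N :: ps))),
     cox u = ('X + 1) * cox v - 'X * cox w) /\
  ((2 <= size (p1 :: ps))%N -> (3 <= p1)%N ->
   forall i : nat, (1 <= i <= size (p1 :: ps))%N ->
   all (leq 3) (take (i - 1) ps) ->
   forall (u : enumeration (Stree i (p1 :: ps)))
          (v : enumeration (Stree (i - 1) (rcons ps (p1 - 1)%N)))
          (w : enumeration (Stree (i - 1) (rcons ps (p1 - 3)%N))),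
     cox u = ('X + 1) * (cox v - 'X * cox w)).
Proof.
split=> [|_].
  case: p1 => [|[|q]] // _ u v w; rewrite subn1 subn2 /= in v w *.
  (* An arbitrary value: edges of type A do not depend on the size, so all three trees share one
     relation. *)
  pose m (j : nat) := 0%N.
  have E p (t : enumeration (Stree 0 p)) :
      cox t = ldet (cox_weight (code_adj (fun=> TypeA) m) height) (codes id p).
    by apply: cox_Stree => [j k _ _|j x y] //=; rewrite ltn0.
  have pL : perm_eq (codes id (q.+2 :: ps))
      [:: Some (0, q.+1), Some (0, q) & codes id (q :: ps)]%N.
    by rewrite (permPl (perm_codes_cons _ _)) perm_cons perm_codes_cons.
  have uL : uniq (codes id (q.+2 :: ps)) by apply: codes_uniq => j k _ _.
  rewrite (perm_uniq pL) in uL.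
  rewrite !E (ldet_perm _ pL) (ldet_perm _ (perm_codes_cons q ps)).
  rewrite ldet_code_leaf //= ?eqxx //.
  move=> [[k y]|//] /mem_codes[_]; case: k => //= yq; lia.
case: p1 => [|[|[|q]]] // _ i /andP[i0 ip] _.
rewrite subSS subn0 (subSS 2) subSS subSS subn0 => u v w.
pose X j := if (j < i)%N then TypeD else TypeA.
pose m j := nth 0%N (q.+3 :: ps) j.
have Eu : cox u =
    ldet (cox_weight (code_adj X m) height) (codes id (q.+3 :: ps)).
  by apply: cox_Stree.
(* Without its last vertex, D_(q+3) is the path A_(q+2); up to this bound the shortened branch can
   therefore be read inside the type D branch 0. *)
have E r (t : enumeration (Stree (i - 1) (rcons ps r))) : (r <= q.+2)%N ->
    cox t = ldet (cox_weight (code_adj X m) height) (codes id (r :: ps)).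
  move=> rq; rewrite -(ldet_perm _ (perm_codes_rcons r ps)).
  apply: cox_Stree => [j k|j x y]; rewrite ?inE size_rcons.
    by rewrite /unrotate => jp kp; do 2![case: ifP]; lia.
  rewrite nth_rcons /unrotate /X /m; case: (ltngtP j (size ps)) => [jp|jp|->] jr.
  - by move=> _ _; rewrite ltn_subRL.
  - lia.
  (* Since i is at most k, the last of the k branches of the rotated tree lies beyond its i - 1
     branches of type D. *)
  by rewrite i0 ifN /=; move: ip => /=; lia.
have pLv : perm_eq (codes id (q.+2 :: ps))
    [:: Some (0, q), Some (0, q.+1) & codes id (q :: ps)]%N.
  have swap := perm_catCA [:: Some (0, q.+1)]%N [:: Some (0, q)]%N
                          (codes id (q :: ps)).
  apply: perm_trans (introT permPl swap).
  by rewrite (permPl (perm_codes_cons _ _)) /= perm_cons perm_codes_cons.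
(* Positions count from 0: [q] is the fork vertex, [q.+1] and [q.+2] are its two leaves. The leaf to
   expand comes first, then its neighbour, then the leaf that becomes isolated. *)
have pL : perm_eq (codes id (q.+3 :: ps))
    [:: Some (0, q.+2), Some (0, q), Some (0, q.+1) & codes id (q :: ps)]%N.
  by rewrite (permPl (perm_codes_cons _ _)) perm_cons.
have uL : uniq (codes id (q.+3 :: ps)) by apply: codes_uniq => j k _ _.
rewrite (perm_uniq pL) in uL.
have X0 : X 0%N = TypeD by rewrite /X i0.
rewrite Eu !E ?leqnn ?(leq_trans (leqnSn q)) // (ldet_perm _ pL) (ldet_perm _ pLv).
rewrite ldet_code_leaf //.
- rewrite (ldet_code_isolated _ (x := Some (0, q.+1)%N)); first by ring.
  + by case/and3P: uL => _ _ /andP[].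
  move=> [[k y]|] // /mem_codes[_]; rewrite /code_adj /=; case: k => //=.
  by rewrite X0 /m /=; lia.
- by rewrite /= X0 /m /=; lia.
move=> [[k y]|] //; rewrite inE => /orP[/eqP[-> ->]|/mem_codes[_]] /=.
  by rewrite X0 /m /=; lia.
by case: k => //=; rewrite X0 /m /=; lia.
Qed.
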